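(* For $f \in L(X^o)$ and $g \in L(\partial X)$, there is a unique $u \in L(X)$ such that $\Delta u = f$ on $X^o$ and $u = g$ on $\partial X$. The solution is given by $$u|_{X^o} = -G_{X^o} \bigl( f - P_{X^o,\, \partial X}\,g\bigr) \quad\text{and}\quad u|_{\partial X} = g .$$
   Context: Let $(X,E)$ be a finite directed graph with $|X|\ge 2$, $E\subset X^2$ without loops, which is strongly connected. Each edge $(x,y)\in E$ carries a weight $a(x,y)>0$, and $a(x,y)=0$ if $(x,y)\notin E$. Put $m(x)=\sum_y a(x,y)$, $p(x,y)=a(x,y)/m(x)$, $P=(p(x,y))_{x,y\in X}$. $L(B)$ is the space of functions $B\to\mathbb{C}$ (column vectors), $Pu(x)=\sum_y p(x,y)u(y)$, and $\Delta=P-I$. The boundary $\partial X$ is an arbitrary non-empty subset of $X$, and $X^o=X\setminus\partial X$. For $A,B\subset X$, $P_{A,B}=(p(x,y))_{x\in A,y\in B}$ and $P_A=P_{A,A}$. For $A\subsetneq X$, $G_A=(I_A-P_A)^{-1}=\sum_{n\ge0}P_A^n$ (the inverse exists and the series converges). *)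

(* Defs.v *)
From HB Require Import structures.
From mathcomp Require Import all_boot all_order all_algebra.
From mathcomp Require Import reals complex.
Set Implicit Arguments.
Unset Strict Implicit.
Unset Printing Implicit Defensive.
Import Order.TTheory GRing.Theory Num.Theory.
Local Open Scope ring_scope.

(* Functions on a subset B of X are elements of {ffun subtype B -> R[i]}: they
   are defined on B only. *)
Definition subtype (X : finType) (B : {set X}) : finType := {x : X | x \in B}.

Definition restr (R : realType) (X : finType) (B : {set X})
    (u : {ffun X -> R[i]}) : {ffun subtype B -> R[i]} :=
  [ffun x : subtype B => u (val x)].

(* Library matrices are indexed by ordinals; an S x T matrix is read through
   the enumerations of S and T, and acts on functions seen as column vectors. *)
Definition mxact (R : realType) (S T : finType) (M : 'M[R[i]]_(#|S|, #|T|))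
    (u : {ffun T -> R[i]}) : {ffun S -> R[i]} :=
  [ffun x : S => (M *m \col_(j < #|T|) u (enum_val j)) (enum_rank x) 0].

Section Network.
Variables (R : realType) (X : finType) (a : X -> X -> R).

Definition total_weight (x : X) : R := \sum_(y : X) a x y.

Definition trans_prob (x y : X) : R := a x y / total_weight x.

Definition transop (u : {ffun X -> R[i]}) : {ffun X -> R[i]} :=
  [ffun x => \sum_(y : X) (trans_prob x y)%:C%C * u y].

Definition laplacian (u : {ffun X -> R[i]}) : {ffun X -> R[i]} := transop u - u.

Definition Pmx (A B : {set X}) : 'M[R[i]]_(#|subtype A|, #|subtype B|) :=
  \matrix_(i, j) (trans_prob (val (enum_val i)) (val (enum_val j)))%:C%C.

(* invmx is the genuine inverse only when I - P_A is invertible. This holds for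
   every proper subset A when the weighted graph is strongly connected with at
   least two vertices. *)
Definition Green (A : {set X}) : 'M[R[i]]_#|subtype A| :=
  invmx (1%:M - Pmx A A).

Definition Dirichlet_solution (dX : {set X})
    (f : {ffun subtype (~: dX) -> R[i]}) (g : {ffun subtype dX -> R[i]})
    (u : {ffun X -> R[i]}) : Prop :=
  restr (~: dX) (laplacian u) = f /\ restr dX u = g.

End Network.

(* Main.v *)
Require Import Defs.
From mathcomp Require Import all_boot all_order all_algebra.
From mathcomp Require Import reals complex.
Set Implicit Arguments.
Unset Strict Implicit.
Unset Printing Implicit Defensive.
Import Order.TTheory GRing.Theory Num.Theory.
Local Open Scope ring_scope.

(** On the interior the Poisson equation [Delta u = f] splits, according to the
    position of the target of a step, into
    [(I - P_o) (u on X^o) = P_(o,d) (u on dX) - f] where [o] and [d] stand for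
    the interior and the boundary ([restr_laplacian]).  Hence everything rests
    on the invertibility of [I - P_o], which then turns the boundary value
    problem into the explicit formula ([Dirichlet_solutionP]).

    In finite dimension invertibility is injectivity ([unit_I_sub_Pmx]).  A
    vector killed by [I - P_o], extended by zero, is a function harmonic in the
    interior and zero on the boundary, and the maximum modulus principle
    ([harmonic_eq0]) shows that it vanishes: at an interior point where the
    modulus is maximal, the mean value property forces the same modulus at all
    the out-neighbours, so the maximum travels along a directed path, which by
    strong connectedness may be chosen to end on the boundary. *)

(** * Restriction and extension by zero *)

Section Restriction.
Variables (R : realType) (X : finType).
Implicit Types (A B : {set X}) (u v : {ffun X -> R[i]}).

Lemma restrD A u v : restr A (u + v) = restr A u + restr A v.
Proof. by apply/ffunP => x; rewrite !ffunE. Qed.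

Lemma restrB A u v : restr A (u - v) = restr A u - restr A v.
Proof. by apply/ffunP => x; rewrite !ffunE. Qed.

Lemma eq_restr_setC A u v :
  restr A u = restr A v -> restr (~: A) u = restr (~: A) v -> u = v.
Proof.
move=> /ffunP eqA /ffunP eqAC; apply/ffunP => x.
case: (boolP (x \in A)) => Ax.
  by have := eqA (Sub x Ax); rewrite !ffunE.
have ACx : x \in ~: A by rewrite inE.
by have := eqAC (Sub x ACx); rewrite !ffunE.
Qed.

Definition extend0 B (w : {ffun subtype B -> R[i]}) : {ffun X -> R[i]} :=
  [ffun x => oapp w 0 (insub x : option (subtype B))].

Lemma restr_extend0 B (w : {ffun subtype B -> R[i]}) : restr B (extend0 w) = w.
Proof. by apply/ffunP => x; rewrite !ffunE valK. Qed.

Lemma restr_extend0_disjoint A B (w : {ffun subtype B -> R[i]}) :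
  [disjoint A & B] -> restr A (extend0 w) = 0.
Proof.
move=> dAB; apply/ffunP => x; rewrite !ffunE insubF //.
exact: disjointFr dAB (valP x).
Qed.

End Restriction.

(** * Matrices acting on functions *)

Section MatrixAction.
Variable R : realType.

Lemma mxactE (S T : finType) (M : 'M[R[i]]_(#|S|, #|T|))
    (u : {ffun T -> R[i]}) (x : S) :
  mxact M u x = \sum_(y : T) M (enum_rank x) (enum_rank y) * u y.
Proof.
rewrite ffunE mxE [RHS]big_enum_val.
by apply: eq_bigr => j _; rewrite mxE enum_valK.
Qed.

Lemma mxactM (S T U : finType) (M : 'M[R[i]]_(#|S|, #|T|))
    (N : 'M[R[i]]_(#|T|, #|U|)) (u : {ffun U -> R[i]}) :
  mxact (M *m N) u = mxact M (mxact N u).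
Proof.
apply/ffunP => x; rewrite !ffunE -mulmxA; congr ((M *m _) _ _).
by apply/colP => j; rewrite !mxE ffunE enum_valK mxE.
Qed.

Lemma mxact1 (S : finType) (u : {ffun S -> R[i]}) : mxact 1%:M u = u.
Proof. by apply/ffunP => x; rewrite ffunE mul1mx mxE enum_rankK. Qed.

Lemma mxactBl (S T : finType) (M N : 'M[R[i]]_(#|S|, #|T|))
    (u : {ffun T -> R[i]}) : mxact (M - N) u = mxact M u - mxact N u.
Proof. by apply/ffunP => x; rewrite !ffunE mulmxBl !mxE. Qed.

Lemma mxactN (S T : finType) (M : 'M[R[i]]_(#|S|, #|T|))
    (u : {ffun T -> R[i]}) : mxact M (- u) = - mxact M u.
Proof.
apply/ffunP => x; rewrite [RHS]ffunE !mxactE -sumrN.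
by apply: eq_bigr => y _; rewrite ffunE mulrN.
Qed.

Lemma mxact0 (S T : finType) (M : 'M[R[i]]_(#|S|, #|T|)) : mxact M 0 = 0.
Proof.
by apply/ffunP => x; rewrite mxactE big1 ?ffunE // => y _; rewrite ffunE mulr0.
Qed.

Lemma mxact_inj_unitmx (S : finType) (M : 'M[R[i]]_#|S|) :
  (forall u : {ffun S -> R[i]}, mxact M u = 0 -> u = 0) -> M \in unitmx.
Proof.
move=> M_inj; rewrite -unitmx_tr -row_free_unit; apply: inj_row_free => v vM0.
pose u : {ffun S -> R[i]} := [ffun x => v 0 (enum_rank x)].
have colu : \col_(j < #|S|) u (enum_val j) = v^T.
  by apply/colP => j; rewrite !mxE ffunE enum_valK.
have /M_inj/ffunP u0 : mxact M u = 0.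
  by apply/ffunP => x; rewrite ffunE colu -[M]trmxK -trmx_mul vM0 !mxE ffunE.
by apply/rowP => j; have := u0 (enum_val j); rewrite !ffunE enum_valK mxE.
Qed.

Lemma mxact_invmx (S : finType) (M : 'M[R[i]]_#|S|) (u w : {ffun S -> R[i]}) :
  M \in unitmx -> mxact M u = w <-> u = mxact (invmx M) w.
Proof.
by move=> uM; split=> [<-|->]; rewrite -mxactM ?mulVmx ?mulmxV // mxact1.
Qed.

End MatrixAction.

(** * The Laplacian in block form *)

Section Blocks.
Variables (R : realType) (X : finType) (a : X -> X -> R).
Implicit Types (A B : {set X}) (u : {ffun X -> R[i]}).

Lemma mxact_Pmx A B u (x : subtype A) :
  mxact (Pmx a A B) (restr B u) x =
  \sum_(y in B) (trans_prob a (val x) y)%:C%C * u y.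
Proof.
rewrite mxactE [RHS]big_sub; apply: eq_bigr => y _.
by rewrite mxE !enum_rankK ffunE.
Qed.

Lemma restr_transop A B u :
  restr A (transop a u) =
  mxact (Pmx a A B) (restr B u) + mxact (Pmx a A (~: B)) (restr (~: B) u).
Proof.
apply/ffunP => x; rewrite [RHS]ffunE !mxact_Pmx !ffunE (bigID (mem B)) /=.
by congr (_ + _); apply: eq_bigl => y; rewrite !inE.
Qed.

Lemma restr_laplacian dX u :
  restr (~: dX) (laplacian a u) =
  mxact (Pmx a (~: dX) dX) (restr dX u)
    - mxact (1%:M - Pmx a (~: dX) (~: dX)) (restr (~: dX) u).
Proof.
by rewrite restrB (restr_transop _ dX) mxactBl mxact1 opprB addrA.
Qed.

End Blocks.

(** * The maximum modulus principle *)

Section MaximumPrinciple.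
Variables (R : realType) (X : finType) (E : rel X) (a : X -> X -> R).
Hypotheses (X_ge2 : (2 <= #|X|)%N)
  (E_strong : forall x y : X, connect E x y)
  (a_edge : forall x y : X, E x y -> 0 < a x y)
  (a_nonedge : forall x y : X, ~~ E x y -> a x y = 0).

Lemma weight_ge0 x y : 0 <= a x y.
Proof. by case: (boolP (E x y)) => [/a_edge/ltW|/a_nonedge->]. Qed.

(** A second vertex exists, and a path towards it must leave [x]. *)
Lemma total_weight_gt0 x : 0 < total_weight a x.
Proof.
have [z /=] : exists z, z \in predC1 x.
  by apply/card_gt0P; rewrite cardC1 -ltnS prednK // (ltn_trans _ X_ge2).
case/connectP: (E_strong x z) => -[|y p] /=; first by move=> _ ->; rewrite !inE eqxx.
case/andP=> Exy _ _ _; rewrite /total_weight (bigD1 y) //=.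
by apply: ltr_wpDr; [apply: sumr_ge0 => ? _; apply: weight_ge0 | apply: a_edge].
Qed.

Lemma trans_prob_ge0 x y : 0 <= trans_prob a x y.
Proof. by rewrite divr_ge0 ?weight_ge0 // ltW // total_weight_gt0. Qed.

Lemma trans_prob_gt0 x y : E x y -> 0 < trans_prob a x y.
Proof. by move=> Exy; rewrite divr_gt0 ?a_edge // total_weight_gt0. Qed.

Lemma sum_trans_prob x : \sum_y (trans_prob a x y)%:C%C = 1 :> R[i].
Proof.
rewrite -(rmorph_sum (real_complex R)) /= -mulr_suml divff //.
by rewrite gt_eqF // total_weight_gt0.
Qed.

(** [|u x|] is at most the [p(x, .)]-average of [|u|], and no value exceeds
    [|u x|]; so the average can only be attained with all the values equal. *)
Lemma max_modulus_step (u : {ffun X -> R[i]}) x y :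
  transop a u x = u x -> (forall z, `|u z| <= `|u x|) -> E x y ->
  `|u y| = `|u x|.
Proof.
move=> harm max_x Exy.
have gap_ge0 z : true -> 0 <= (trans_prob a x z)%:C%C * (`|u x| - `|u z|).
  by move=> _; rewrite mulr_ge0 ?subr_ge0 // ler0c trans_prob_ge0.
have gap0 : \sum_z (trans_prob a x z)%:C%C * (`|u x| - `|u z|) = 0.
  apply/le_anti; rewrite sumr_ge0 // andbT.
  under eq_bigr => z _ do rewrite mulrBr.
  rewrite sumrB -mulr_suml sum_trans_prob mul1r subr_le0.
  rewrite -{1}harm ffunE; apply: le_trans (ler_norm_sum _ _ _) _.
  apply: ler_sum => z _; rewrite normrM ger0_norm //.
  by rewrite ler0c trans_prob_ge0.
have /eqP := psumr_eq0P gap_ge0 gap0 (i := y) isT.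
rewrite mulf_eq0 => /orP[|]; last by rewrite subr_eq0 => /eqP.
by rewrite gt_eqF // (ltcR 0) trans_prob_gt0.
Qed.

Lemma harmonic_eq0 dX (u : {ffun X -> R[i]}) : dX != set0 ->
  restr (~: dX) (laplacian a u) = 0 -> restr dX u = 0 -> u = 0.
Proof.
move=> /set0Pn[b bdX] /ffunP harm /ffunP u_dX.
have u0 x : x \in dX -> u x = 0.
  by move=> xdX; have := u_dX (Sub x xdX); rewrite !ffunE.
have mean x : x \notin dX -> transop a u x = u x.
  rewrite -in_setC => xI; have /eqP := harm (Sub x xI).
  by rewrite ![in X in X == _]ffunE [X in _ == X]ffunE /= subr_eq0 ffunE => /eqP.
(* The moduli are elements of [R[i]], which is only partially ordered; they
   have a maximum because they are real. *)
have [x0 _ max_x0] := real_arg_maxP (F := fun x => `|u x|) (i0 := b)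
  (P := xpredT) isT (fun x _ => normr_real (u x)).
(* The path need not stay in the interior: the first boundary vertex that it
   meets already carries the maximum, which is then the boundary value 0. *)
have max0 p x : `|u x| = `|u x0| -> path E x p -> last x p \in dX ->
    `|u x0| = 0.
  elim: p x => [|y p IHp] x eqx /=; first by
    move=> _ /u0 ux0; rewrite -eqx ux0 normr0.
  case/andP=> Exy; case: (boolP (x \in dX)) => [/u0 ux0|/mean mx].
    by rewrite -eqx ux0 normr0.
  apply: IHp; rewrite (max_modulus_step mx _ Exy) // => z.
  by rewrite eqx; apply: max_x0.
case/connectP: (E_strong x0 b) => p Ep eb.
have {}max0 : `|u x0| = 0 by apply: (max0 p x0) => //; rewrite -eb.
apply/ffunP => x; rewrite ffunE; apply/eqP; rewrite -normr_le0 -max0.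
exact: max_x0.
Qed.

(** * Invertibility and the solution formula *)

Lemma unit_I_sub_Pmx dX : dX != set0 ->
  1%:M - Pmx a (~: dX) (~: dX) \in unitmx.
Proof.
move=> dX0; apply: mxact_inj_unitmx => w w_ker.
have ext_dX : restr dX (extend0 w) = 0.
  by apply: restr_extend0_disjoint; rewrite -subsets_disjoint.
rewrite -[LHS]restr_extend0 (harmonic_eq0 dX0 _ ext_dX).
  by apply/ffunP => x; rewrite !ffunE.
by rewrite restr_laplacian ext_dX mxact0 restr_extend0 w_ker subr0.
Qed.

Lemma Dirichlet_solutionP dX f g (u : {ffun X -> R[i]}) : dX != set0 ->
  Dirichlet_solution a f g u <->
  restr (~: dX) u
    = - mxact (Green a (~: dX)) (f - mxact (Pmx a (~: dX) dX) g) /\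
  restr dX u = g.
Proof.
move=> /unit_I_sub_Pmx uI; rewrite -mxactN opprB /Dirichlet_solution restr_laplacian.
split=> -[eqI eqd]; split=> //; move: eqI; rewrite eqd.
  by move=> <-; apply/(mxact_invmx _ _ uI); rewrite subKr.
by move=> /(mxact_invmx _ _ uI) ->; rewrite subKr.
Qed.

End MaximumPrinciple.

Theorem mainTheorem3 (R : realType) (X : finType) (E : rel X)
    (a : X -> X -> R) (dX : {set X})
    (X_ge2 : (2 <= #|X|)%N)
    (E_loopless : irreflexive E)
    (E_strong : forall x y : X, connect E x y)
    (a_edge : forall x y : X, E x y -> 0 < a x y)
    (a_nonedge : forall x y : X, ~~ E x y -> a x y = 0)
    (dX_nonempty : dX != set0)
    (f : {ffun subtype (~: dX) -> R[i]}) (g : {ffun subtype dX -> R[i]}) :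
  (exists! u : {ffun X -> R[i]}, Dirichlet_solution a f g u) /\
  (forall u : {ffun X -> R[i]}, Dirichlet_solution a f g u ->
     restr (~: dX) u
       = - mxact (Green a (~: dX)) (f - mxact (Pmx a (~: dX) dX) g) /\
     restr dX u = g).
Proof.
have solP u : Dirichlet_solution a f g u <-> _ :=
  Dirichlet_solutionP X_ge2 E_strong a_edge a_nonedge f g u dX_nonempty.
split; last by move=> u /solP.
set w := - mxact _ _ in solP.
have dIX : [disjoint ~: dX & dX] by rewrite disjoint_sym -subsets_disjoint.
have glueI : restr (~: dX) (extend0 w + extend0 g) = w.
  by rewrite restrD restr_extend0 restr_extend0_disjoint // addr0.
have glued : restr dX (extend0 w + extend0 g) = g.
  by rewrite restrD restr_extend0 restr_extend0_disjoint ?add0r // disjoint_sym.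
exists (extend0 w + extend0 g); split=> [|v /solP[vI vd]].
  exact/solP.
by apply: (@eq_restr_setC _ _ dX); rewrite ?glueI ?glued.
Qed.
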